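(* Let $\mathcal{C}$ be a $k$-dimensional $\mathbb{F}_{q^n}$-subspace of $V$ with $\Omega(\mathcal{C})^\perp\cap\Sigma=\emptyset$. Then for any $\mathbb{F}_{q^n}$-basis $\{f_1,\ldots,f_k\}$ of $\mathcal{C}$ we have $U_{f_1,\ldots,f_k}\cong V_0/\mathcal{C}^\perp$, where $V_0$ is an $\mathbb{F}_q$-subspace of $V$ satisfying $\Omega(V_0)=\Sigma$, and $L_{f_1,\ldots,f_k}\cong\Sigma/\Omega(\mathcal{C})^\perp$ (projective equivalence). Therefore $\Sigma/\Omega(\mathcal{C})^\perp\in\mathcal{L}_\mathcal{C}$.
   Context: $V=\mathrm{End}_{\mathbb{F}_q}(\mathbb{F}_{q^n})$, viewed as the $n$-dimensional $\mathbb{F}_{q^n}$-space of linearised polynomials $f(x)=\sum_{i=0}^{n-1}f_ix^{q^i}$, identified with coefficient vectors in $\mathbb{F}_{q^n}^n$; $\mathrm{PG}(V)=\mathrm{PG}(n-1,q^n)$. $\Omega(\mathcal{C})=\{\langle f\rangle_{q^n}:f\in\mathcal{C}\setminus\{0\}\}$. $\Sigma=\{(\beta,\beta^q,\ldots,\beta^{q^{n-1}})_{q^n}:\beta\in\mathbb{F}_{q^n}^*\}$ (the points given by rank-one maps; an $\mathbb{F}_q$-subgeometry). $\perp$ is w.r.t. the dot product $f\cdot g=\sum_i f_ig_i$. $\Sigma/\Omega(\mathcal{C})^\perp$ denotes the set of points of the quotient geometry $\mathrm{PG}(V/\mathcal{C}^\perp)\cong\mathrm{PG}(k-1,q^n)$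 given by the spaces $\langle P,\Omega(\mathcal{C})^\perp\rangle$, $P\in\Sigma$ (equivalently, the projection of $\Sigma$ from $\Omega(\mathcal{C})^\perp$ onto a $(k-1)$-space skew to it). $U_{f_1,\ldots,f_k}=\{(f_1(x),\ldots,f_k(x)):x\in\mathbb{F}_{q^n}\}\subseteq V(k,q^n)$, $L_{f_1,\ldots,f_k}=\{(f_1(x),\ldots,f_k(x))_{q^n}:x\in\mathbb{F}_{q^n}^*\}$, and $\mathcal{L}_\mathcal{C}=\{L_{f_1,\ldots,f_k}:\mathcal{C}=\langle f_1,\ldots,f_k\rangle_{q^n}\}$. *)

(* Defs.v *)
From HB Require Import structures.
From mathcomp Require Import all_boot all_algebra all_field.
From mathcomp Require Import sesquilinear classical_sets.

Set Implicit Arguments.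
Unset Strict Implicit.
Unset Printing Implicit Defensive.

Import GRing.Theory.
Local Open Scope ring_scope.
Local Open Scope quotient_scope.
Local Open Scope classical_set_scope.

(* [quotv S] is the quotient vector space vT / S: the library quotient of the
   additive group vT by S, equipped with the induced K-vector space structure. *)
Section QuotientSpace.
Variables (K : fieldType) (vT : vectType K) (S : {vspace vT}).

Definition quotv := Quotient.quot (pred_of_vspace S).

HB.instance Definition _ := GRing.Zmodule.on quotv.
HB.instance Definition _ := Quotient.on quotv.

Lemma pi_quotv_eq (u v : vT) : (\pi_quotv u == \pi_quotv v) = (u - v \in S).
Proof. by rewrite -Quotient.idealrBE. Qed.

Lemma pi_quotvD (u v : vT) : \pi_quotv (u + v) = \pi_quotv u + \pi_quotv v.
Proof. exact: (raddfD (\pi_(Quotient.quot (pred_of_vspace S)))). Qed.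

Definition scaleq (a : K) (q : quotv) : quotv := \pi_quotv (a *: repr q).

Lemma pi_quotvZ (a : K) (v : vT) : \pi_quotv (a *: v) = scaleq a (\pi_quotv v).
Proof.
apply/eqP; rewrite pi_quotv_eq -scalerBr; apply: memvZ.
by rewrite -pi_quotv_eq reprK.
Qed.

Fact scaleqA a b q : scaleq a (scaleq b q) = scaleq (a * b) q.
Proof. by rewrite -[q]reprK -(pi_quotvZ b) -!pi_quotvZ scalerA. Qed.
Fact scale1q : left_id 1 scaleq.
Proof. by move=> q; rewrite -[q]reprK -pi_quotvZ scale1r. Qed.
Fact scaleqDr : right_distributive scaleq +%R.
Proof.
move=> a q r; rewrite -[q]reprK -[r]reprK -pi_quotvD -!pi_quotvZ.
by rewrite scalerDr pi_quotvD.
Qed.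
Fact scaleqDl q : {morph scaleq^~ q : a b / a + b}.
Proof.
by move=> a b; rewrite -[q]reprK -!pi_quotvZ scalerDl pi_quotvD.
Qed.

HB.instance Definition _ := GRing.Zmodule_isLmodule.Build K quotv
  scaleqA scale1q scaleqDr scaleqDl.

Fact quotv_vect_axiom : Vector.axiom (\dim (S^C)%VS) quotv.
Proof.
pose b := vbasis (S^C)%VS.
pose p : vT -> vT := daddv_pi (S^C)%VS S.
have capCS : ((S^C) :&: S = 0)%VS by rewrite capvC capv_compl.
have pS v : v - p v \in S.
  have vT_sum : v \in ((S^C) + S)%VS by rewrite addvC addv_complf memvf.
  by rewrite -{1}(daddv_pi_add capCS vT_sum) /p [X in X - _]addrC addrK memv_pi.
have pC v : p v \in (S^C)%VS by apply: memv_pi.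
have p0 v : v \in S -> p v = 0.
  move=> vS; apply/eqP; rewrite -memv0 -capCS memv_cap pC /=.
  by rewrite -[p v](subKr v) memvB.
have piE (q : quotv) v : q = \pi_quotv v -> p (repr q) = p v.
  move=> qE; have /p0 : repr q - v \in S by rewrite -pi_quotv_eq reprK qE.
  by rewrite /p linearB => /eqP; rewrite subr_eq0 => /eqP.
pose f (q : quotv) : 'rV[K]_(\dim (S^C)%VS) := \row_i coord b i (p (repr q)).
pose g (r : 'rV[K]_(\dim (S^C)%VS)) : quotv := \pi_quotv (\sum_i r 0 i *: b`_i).
exists f.
  move=> a q r; apply/rowP=> i; rewrite !mxE -linearP; congr (coord b i _).
  rewrite /p -linearP; apply: piE.
  by rewrite pi_quotvD pi_quotvZ !reprK.
exists g => [q|r].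
  apply/esym/eqP; rewrite -[X in X == _]reprK pi_quotv_eq.
  under eq_bigr do rewrite mxE.
  by rewrite -coord_vbasis.
apply/rowP=> i; rewrite mxE.
have sC : \sum_i r 0 i *: b`_i \in (S^C)%VS.
  by apply: memv_suml => j _; apply/memvZ/vbasis_mem/memt_nth.
rewrite (piE _ _ erefl) [p _]daddv_pi_id //.
by rewrite coord_sum_free // (basis_free (vbasisP _)).
Qed.

HB.instance Definition _ := Lmodule_hasFinDim.Build K quotv quotv_vect_axiom.

Fact pi_quotv_linear : linear (\pi_quotv : vT -> quotv).
Proof. by move=> a u v; rewrite pi_quotvD pi_quotvZ. Qed.
HB.instance Definition _ := GRing.isLinear.Build K vT quotv *:%R
  (\pi_quotv : vT -> quotv) pi_quotv_linear.

Definition projq : 'Hom(vT, quotv) := linfun (\pi_quotv : vT -> quotv).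

Lemma lker_projq : lker projq = S.
Proof.
apply/vspaceP=> v; rewrite memv_ker lfunE /=.
by rewrite -(linear0 (\pi_quotv : vT -> quotv)) pi_quotv_eq subr0.
Qed.

Lemma limg_projq : limg projq = fullv.
Proof.
apply/vspaceP=> q; rewrite memvf; apply/memv_imgP.
by exists (repr q); rewrite ?memvf // lfunE /= reprK.
Qed.

End QuotientSpace.

Section Dot.
Variables (K : fieldType) (n : nat).

Definition dotp (u v : 'rV[K]_n) : K := \sum_i u 0 i * v 0 i.

Fact dotpl_linear v : linear_for *%R (dotp^~ v).
Proof.
move=> a x y /=; rewrite /dotp mulr_sumr -big_split; apply: eq_bigr => i _ /=.
by rewrite !mxE mulrDl mulrA.
Qed.
Fact dotpr_linear u : linear_for (idfun \; *%R) (dotp u).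
Proof.
move=> a x y /=; rewrite /dotp mulr_sumr -big_split; apply: eq_bigr => i _ /=.
by rewrite !mxE mulrDr mulrCA.
Qed.
HB.instance Definition _ := bilinear_isBilinear.Build K 'rV[K]_n 'rV[K]_n K
  *%R (idfun \; *%R) dotp (dotpl_linear, dotpr_linear).
Fact dotp_sym u v : dotp u v = (-1) ^+ false * dotp v u.
Proof. by rewrite mul1r; apply: eq_bigr => i _; rewrite mulrC. Qed.
HB.instance Definition _ := isHermitianSesquilinear.Build K 'rV[K]_n
  false idfun dotp dotp_sym.

Definition orthd (C : {vspace 'rV[K]_n}) : {vspace 'rV[K]_n} := orthov dotp C.

Lemma orthdP (C : {vspace _}) u :
  reflect (forall v, v \in C -> dotp u v = 0) (u \in orthd C).
Proof. exact: mem_orthovP. Qed.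

End Dot.

Section Geometry.
Variables (K : fieldType) (vT wT : vectType K).

Definition Omega (U : set vT) : set {vspace vT} :=
  [set P | exists2 f, U f /\ f != 0 & P = <[f]>%VS].

(* The points <P, S> of PG(vT / S), for P in X. *)
Definition quotpts (S : {vspace vT}) (X : set {vspace vT}) :
    set {vspace (quotv S)} :=
  [set (projq S @: (P + S))%VS | P in X].

Definition quotset (S : {vspace vT}) (U : set vT) : set (quotv S) :=
  [set projq S u | u in U].

(* U and W are matched by a K-linear bijection of the ambient spaces, not merely
   by an additive bijection between U and W. *)
Definition lin_equiv (U : set vT) (W : set wT) : Prop :=
  exists2 phi : 'Hom(vT, wT), bijective phi & [set phi u | u in U] = W.

(* The image of a set of points under the collineation induced by phi. *)
Definition imgpts (phi : 'Hom(vT, wT)) (X : set {vspace vT}) :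
    set {vspace wT} :=
  [set (phi @: P)%VS | P in X].

Definition proj_equiv (X : set {vspace vT}) (Y : set {vspace wT}) : Prop :=
  exists2 phi : 'Hom(vT, wT), bijective phi & imgpts phi X = Y.

End Geometry.

(* F = F_q and L = F_(q^n); 'rV[L]_n is the space of coefficient vectors
   (f_0, ..., f_(n-1)) of the linearised polynomials. *)
Section Linearised.
Variables (F : finFieldType) (L : fieldExtType F) (n : nat).

Definition lpoly (f : 'rV[L]_n) (x : L) : L :=
  \sum_(i < n) f 0 i * x ^+ (#|F| ^ i).

Lemma lpoly_linear f : linear (lpoly f).
Proof.
have [p p_pr pF] := finPcharP F.
have pL : p \in [pchar L] by rewrite (pchar_lalg L).
move=> a x y /=; rewrite /lpoly scaler_sumr -big_split; apply: eq_bigr => i _ /=.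
have aq : a ^+ (#|F| ^ i) = a.
  by elim: (i : nat) => // j IH; rewrite expnS exprM expf_card.
have q_pnat : [pchar L].-nat (#|F| ^ i)%N.
  rewrite (eq_pnat _ (pcharf_eq pL)) pnatX (card_pprimeChar pF : #|F| = _).
  by rewrite pnatX pnat_id.
rewrite exprDn_pchar //.
by rewrite exprZn aq mulrDr -scalerAr.
Qed.

(* moore b represents the rank-one map x |-> Tr(b x) from L to F. *)
Definition moore (b : L) : 'rV[L]_n := \row_(i < n) b ^+ (#|F| ^ i).

Definition Sigma : set {vspace 'rV[L]_n} :=
  [set <[moore b]>%VS | b in [set b : L | b != 0]].

(* U is stable under F-linear combinations; a%:A is the image in L of the scalar a of F. *)
Definition Fsubspace (U : set 'rV[L]_n) : Prop :=
  U 0 /\ forall (a : F) u v, U u -> U v -> U ((a%:A : L) *: u + v).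

Variable k : nat.

Definition evalv (f : k.-tuple 'rV[L]_n) (x : L) : 'rV[L]_k :=
  \row_(j < k) lpoly (tnth f j) x.

Definition Uset (f : k.-tuple 'rV[L]_n) : set 'rV[L]_k :=
  [set evalv f x | x in [set: L]].

(* A line of 'rV[L]_k for each x such that evalv f x != 0; the condition
   "Omega (orthd C) and Sigma are disjoint" on C = <<f>> makes this hold for all
   x != 0. *)
Definition Lset (f : k.-tuple 'rV[L]_n) : set {vspace 'rV[L]_k} :=
  [set <[evalv f x]>%VS | x in [set x : L | x != 0]].

Definition Lclass (C : {vspace 'rV[L]_n}) : set (set {vspace 'rV[L]_k}) :=
  [set Lset f | f in [set f : k.-tuple 'rV[L]_n | C = <<f>>%VS]].

End Linearised.

Arguments quotpts {K vT} S X.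
Arguments quotset {K vT} S U.
Arguments Sigma {F} L n.
Arguments Lclass {F L n} k C.

(* Main.v *)
From HB Require Import structures.
Require Import Defs.
From mathcomp Require Import all_boot all_algebra all_field.
From mathcomp Require Import sesquilinear classical_sets.

Set Implicit Arguments.
Unset Strict Implicit.
Unset Printing Implicit Defensive.

Import GRing.Theory.
Local Open Scope ring_scope.
Local Open Scope classical_set_scope.

(** Since f(x) = f . moore x, the vector evalv f x is the image of moore x under
    the L-linear map v |-> (f_j . v)_j, which for a basis f of C is onto L^k with
    kernel C^perp; hence it induces an isomorphism V / C^perp -> L^k.  Conversely
    any linear V -> L^k has this form.  Finally, a linearised polynomial of
    q-degree < n has fewer than q^n roots, so every F-linear functional on L is
    b |-> u . moore b for some u; such functionals show that an F-subspace V0 with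
    Omega V0 = Sigma is l *: moore L for a scalar l. *)

Lemma bijective_lker0 (K : fieldType) (aT rT : vectType K) (g : 'Hom(aT, rT)) :
  lker g = 0%VS -> limg g = fullv -> bijective g.
Proof.
move=> /eqP kg0 imgf; exists (g^-1)%VF; first exact: lker0_lfunK.
by move=> u; rewrite limg_lfunVK // imgf memvf.
Qed.

(** * Quotients by the kernel of a surjection *)

Section FirstIso.
Variables (K : fieldType) (vT wT : vectType K).

Lemma projq0 (S : {vspace vT}) v : (projq S v == 0) = (v \in S).
Proof. by rewrite -memv_ker lker_projq. Qed.

Lemma limg_projq_add (S : {vspace vT}) v :
  (projq S @: (<[v]> + S) = <[projq S v]>)%VS.
Proof.
rewrite limgD limg_line; have /eqP -> : (projq S @: S == 0)%VS.
  by rewrite -lkerE lker_projq.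
exact: addv0.
Qed.

(** As [g] is onto, [g^-1] is a right inverse, and two preimages of one vector differ by an element
    of [lker g]. Hence projecting after [g^-1] is independent of the preimage chosen. *)
Lemma first_iso (g : 'Hom(vT, wT)) : limg g = fullv ->
  exists2 phi : 'Hom(wT, quotv (lker g)), bijective phi &
    forall v, phi (g v) = projq (lker g) v.
Proof.
move=> gT; pose phi : 'Hom(wT, quotv (lker g)) := (projq (lker g) \o g^-1)%VF.
have gVK w : g (g^-1%VF w) = w by rewrite limg_lfunVK // gT memvf.
have phiE v : phi (g v) = projq (lker g) v.
  apply/eqP; rewrite comp_lfunE -subr_eq0 -linearB projq0 memv_ker.
  by rewrite linearB /= gVK subrr.
exists phi => //; apply: bijective_lker0.
  apply/eqP; rewrite -subv0; apply/subvP=> w; rewrite memv_ker comp_lfunE projq0.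
  by rewrite memv_ker gVK memv0.
apply/vspaceP=> q; rewrite memvf; apply/memv_imgP.
have /memv_imgP[v _ ->] : q \in limg (projq (lker g)).
  by rewrite limg_projq memvf.
by exists (g v); rewrite ?memvf ?phiE.
Qed.

End FirstIso.

(** * Linear maps whose coordinates are dot products *)

Section DotMap.
Variables (K : fieldType) (n k : nat).
Implicit Types f : k.-tuple 'rV[K]_n.

Definition dotmap_fun f (v : 'rV[K]_n) : 'rV[K]_k :=
  \row_(j < k) dotp (tnth f j) v.

Fact dotmap_linear f : linear (dotmap_fun f).
Proof. by move=> a u v; apply/rowP=> j; rewrite !mxE linearPr. Qed.
HB.instance Definition _ f :=
  GRing.isLinear.Build K 'rV[K]_n 'rV[K]_k *:%R (dotmap_fun f) (dotmap_linear f).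

Definition dotmap f : 'Hom('rV[K]_n, 'rV[K]_k) := linfun (dotmap_fun f).

Lemma dotmapE f v : dotmap f v = \row_(j < k) dotp (tnth f j) v.
Proof. by rewrite lfunE. Qed.

Lemma dotpC (u v : 'rV[K]_n) : dotp u v = dotp v u.
Proof. by rewrite dotp_sym mul1r. Qed.

Lemma lker_dotmap f : lker (dotmap f) = orthd <<f>>%VS.
Proof.
apply/vspaceP=> v; rewrite memv_ker dotmapE; apply/eqP/orthdP => [v0 u|vf].
  move/coord_span->; rewrite linear_sumr big1 // => i _; rewrite linearZr /=.
  have /rowP/(_ i) := v0; rewrite !mxE -tnth_nth dotpC => -> /=.
  by rewrite mulr0.
by apply/rowP=> j; rewrite !mxE dotpC vf // memv_span // mem_tnth.
Qed.

(** Freeness gives the matrix [M] with rows [f_j] a right inverse [B]; then [w *m B^T] is a preimage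
    of [w]. *)
Lemma limg_dotmap f : free f -> limg (dotmap f) = fullv.
Proof.
move=> f_free; pose M := \matrix_(j < k) tnth f j.
have /row_freeP[B MB] : row_free M.
  apply: inj_row_free => v; rewrite mulmx_sum_row => vM0.
  move/freeP: f_free => /(_ (v 0)) v0; apply/rowP=> j; rewrite mxE v0 //.
  by rewrite -[RHS]vM0; apply: eq_bigr => i _; rewrite rowK -tnth_nth.
apply/vspaceP=> w; rewrite memvf; apply/memv_imgP.
exists (w *m B^T); rewrite ?memvf // dotmapE; apply/rowP=> j; rewrite mxE.
have {1}-> : w = w *m B^T *m M^T by rewrite -mulmxA -trmx_mul MB trmx1 mulmx1.
by rewrite mxE dotpC; apply: eq_bigr => i _; rewrite !mxE.
Qed.

(** The vector [f_j] collects the [j]-th coordinates of the images under [g] of the unit vectors. *)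
Lemma dotmap_rows (g : 'Hom('rV[K]_n, 'rV[K]_k)) : exists f, dotmap f = g.
Proof.
exists [tuple \row_i g (delta_mx 0 i) 0 j | j < k].
apply/lfunP=> v; rewrite dotmapE; apply/rowP=> j; rewrite mxE tnth_mktuple.
rewrite [in RHS](row_sum_delta v) linear_sum summxE; apply: eq_bigr => i _.
by rewrite linearZ !mxE mulrC.
Qed.

End DotMap.

(** * Dimension of the orthogonal space and double orthogonality *)

Section DoubleOrthogonal.
Variables (K : fieldType) (n : nat).
Implicit Types C : {vspace 'rV[K]_n}.

(** Rank-nullity for [dotmap] of a basis of [C], which is onto with kernel [orthd C]. *)
Lemma dim_orthd C : (\dim (orthd C) + \dim C = n)%N.
Proof.
have /andP[/eqP spanC /limg_dotmap imgC] := vbasisP C.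
have := limg_ker_dim (dotmap (vbasis C)) fullv.
rewrite capfv lker_dotmap spanC imgC !dimvf !dim_matrix.
by rewrite /GRing.mul /= !mul1n.
Qed.

Lemma orthdK C : orthd (orthd C) = C.
Proof.
apply/esym/eqP; rewrite eqEdim; apply/andP; split.
  by apply/subvP=> v vC; apply/orthdP=> u /orthdP/(_ v vC); rewrite dotpC.
by rewrite -(leq_add2l (\dim (orthd C))) dim_orthd addnC dim_orthd.
Qed.

Lemma span_dotmap k (f : k.-tuple 'rV[K]_n) C : lker (dotmap f) = orthd C -> <<f>>%VS = C.
Proof. by move=> kerf; rewrite -[LHS]orthdK -lker_dotmap kerf orthdK. Qed.

End DoubleOrthogonal.

(** * Linearised polynomials, Moore vectors, and the F-subspaces lying over [Sigma] *)

Section Linearised.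
Variables (F : finFieldType) (L : fieldExtType F) (n : nat).
Hypothesis dimL : \dim {:L} = n.

Let n_gt0 : (0 < n)%N.
Proof. by rewrite -dimL adim_gt0. Qed.

Lemma lpoly_eq0 (f : 'rV[L]_n) : (forall x, lpoly f x = 0) -> f = 0.
Proof.
move=> f0; pose p : {poly L} := \sum_(i < n) f 0 i *: 'X^(#|F| ^ i).
have F_gt1 : (1 < #|F|)%N by exact: finNzRing_gt1.
suff p0 : p = 0.
  apply/rowP=> i; rewrite mxE; have := congr1 (fun r : {poly L} => r`_(#|F| ^ i)) p0.
  rewrite coef0 coef_sum (bigD1 i) //= coefZ coefXn eqxx mulr1 big1 ?addr0 // => j ji.
  by rewrite coefZ coefXn eqn_exp2l // eq_sym (inj_eq val_inj) (negPf ji) mulr0.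
(* [finvect_type L] equips [L] with an enumeration, so that its [#|F| ^ n] elements can serve as a
   list of distinct roots. *)
apply/eqP/contraT=> p_neq0; pose rs : seq L := enum (finvect_type L).
have size_rs : size rs = (#|F| ^ n)%N.
  rewrite -dimL -[RHS](card_vspace {: finvect_type L}%VS) card_vspacef.
  exact/esym/cardT.
have /(max_poly_roots p_neq0)/(_ (enum_uniq _)) : all (root p) rs.
  apply/allP=> x _; apply/eqP; rewrite horner_sum -[RHS](f0 x).
  apply: eq_bigr => i _.
  by rewrite hornerZ hornerXn.
(* The size is the degree plus one: the [i]-th term has size at most [#|F| ^ i + 1], which is at
   most [#|F| ^ n] because [i < n]. *)
rewrite size_rs ltnNge => /negP[]; apply: leq_trans (size_sum _ _ _) _.
apply/bigmax_leqP=> i _; apply: leq_trans (size_scale_leq _ _) _.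
by rewrite size_polyXn ltn_exp2l.
Qed.

HB.instance Definition _ (f : 'rV[L]_n) :=
  GRing.isLinear.Build F L L *:%R (lpoly f) (lpoly_linear f).

Lemma lpoly_dotp (f : 'rV[L]_n) x : lpoly f x = dotp f (moore n x).
Proof. by apply: eq_bigr => i _; rewrite mxE. Qed.

(** Interpolation on an F-basis [e] of [L]. The Moore matrix of [e] is invertible, since a
    linearised polynomial vanishing on [e] vanishes on [L] and is zero by [lpoly_eq0]. *)
Lemma functional_lpoly (T : {scalar L}) :
  exists u : 'rV[L]_n, forall x, dotp u (moore n x) = (T x)%:A.
Proof.
have [e /andP[/eqP span_e _]] : exists e : n.-tuple L, basis_of {:L} e.
  by rewrite -dimL; exists (vbasis {:L}); apply: vbasisP.
have e_ext (g h : {linear L -> L}) :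
    (forall j, g (tnth e j) = h (tnth e j)) -> g =1 h.
  move=> gh x; have xe : x \in <<e>>%VS by rewrite span_e memvf.
  rewrite (coord_span xe) !linear_sum; apply: eq_bigr => j _.
  by rewrite !linearZ -tnth_nth gh.
pose M := \matrix_(i < n, j < n) tnth e j ^+ (#|F| ^ i).
have M_unit : M \in unitmx.
  rewrite -row_free_unit; apply: inj_row_free => v vM0; apply: lpoly_eq0.
  apply: (e_ext (lpoly v) \0) => j /=; have /rowP/(_ j) := vM0.
  rewrite [RHS]mxE => v0; rewrite -[RHS]v0 mxE.
  by apply: eq_bigr => i _; rewrite !mxE.
exists ((\row_j (T (tnth e j))%:A) *m invmx M) => x; rewrite -lpoly_dotp.
have TA_linear : linear (fun y => (T y)%:A : L).
  by move=> a y z; rewrite linearP scalerDl scalerA.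
pose TA : {linear L -> L} := HB.pack (fun y => (T y)%:A : L)
  (GRing.isLinear.Build F L L *:%R _ TA_linear).
apply: (e_ext (lpoly _) TA) => j /=.
have /rowP/(_ j) := mulmxKV M_unit (\row_j (T (tnth e j))%:A).
rewrite [in RHS]mxE => <-; rewrite [RHS]mxE.
by apply: eq_bigr => i _; rewrite !mxE.
Qed.

(** Each coordinate of [moore n] is [lpoly] of a unit vector, hence F-linear. *)
Lemma mooreP a (b c : L) :
  moore n (a *: b + c) = a%:A *: moore n b + moore n c :> 'rV[L]_n.
Proof.
have mooreE x i : moore n x 0 i = lpoly (delta_mx 0 i) x.
  rewrite mxE /lpoly (bigD1 i) //= mxE !eqxx mul1r big1 ?addr0 // => j ji.
  by rewrite mxE (negPf ji) andbF mul0r.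
by apply/rowP=> i; rewrite mooreE linearP [RHS]mxE [in RHS]mxE !mooreE mulr_algl.
Qed.

Lemma moore0 : moore n (0 : L) = 0.
Proof.
apply/rowP=> i; rewrite !mxE expr0n expn_eq0.
by rewrite -leqn0 leqNgt ltnW ?finNzRing_gt1.
Qed.

Lemma mooreZ a (b : L) : moore n (a *: b) = a%:A *: moore n b.
Proof. by rewrite -[a *: b]addr0 mooreP moore0 addr0. Qed.

Lemma moore_inj : injective (@moore F L n).
Proof. by move=> b c /rowP/(_ (Ordinal n_gt0)); rewrite !mxE !expr1. Qed.

Lemma moore_eq0 (b : L) : (moore n b == 0) = (b == 0).
Proof. by rewrite -moore0 (inj_eq moore_inj). Qed.

(** The functionals dual to the F-independent pair [b], [d], written as dot products, turn the
    relation into [a = e * s1] and [c = e * s2] with [s1], [s2] in F; and [s1] is nonzero because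
    [a] is. *)
Lemma moore_comb_ratio a c e (b d g : L) :
  a != 0 -> d != 0 -> b \notin <[d]>%VS ->
  a *: moore n b + c *: moore n d = e *: moore n g :> 'rV[L]_n ->
  exists s : F, c = s%:A * a.
Proof.
move=> a0 d0 bd abcd; have fX : free [tuple b; d].
  by rewrite free_cons seq1_free span_seq1 bd.
have [u1 uE1] := functional_lpoly (coord [tuple b; d] ord0).
have [u2 uE2] := functional_lpoly (coord [tuple b; d] (lift ord0 ord0)).
have coords i j := @coord_free _ _ _ [tuple b; d] i j fX.
have := congr1 (dotp u1) abcd; have := congr1 (dotp u2) abcd.
rewrite !linearDr !linearZr /= !uE1 !uE2.
have /= -> := coords ord0 ord0.
have /= -> := coords (lift ord0 ord0) ord0.
have /= -> := coords ord0 (lift ord0 ord0).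
have /= -> := coords (lift ord0 ord0) (lift ord0 ord0).
rewrite !scale1r !scale0r !mulr1 !mulr0 addr0 add0r => -> aE.
set s1 := coord _ ord0 _ in aE; set s2 := coord _ _ _.
have s1_neq0 : s1 != 0 by apply: contraNneq a0 => s10; rewrite aE s10 scale0r mulr0.
exists (s2 / s1); rewrite aE mulrCA; congr (_ * _).
by rewrite mulr_algl scalerA divfK.
Qed.

(** Every vector of [V0] is a multiple of a Moore vector, and every Moore point is reached. Closure
    under sums forces the nonzero multipliers to be F-proportional, and [mooreZ] absorbs the factors
    from F. *)
Lemma Omega_Sigma_scaled_moore (V0 : set 'rV[L]_n) :
  Fsubspace V0 -> Omega V0 = Sigma L n ->
  exists2 l : L, l != 0 & V0 = [set l *: moore n b | b in [set: L]].
Proof.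
move=> [V00 V0P] OS.
have ptV v : V0 v -> exists c b, v = c *: moore n b.
  move=> V0v; have [->|v0] := eqVneq v 0; first by exists 0, 0; rewrite scale0r.
  have : Omega V0 <[v]>%VS by exists v.
  rewrite OS => -[b _ bE]; have := memv_line v; rewrite -bE => /vlineP[c ->].
  by exists c, b.
have ptS d : d != 0 -> exists2 c, c != 0 & V0 (c *: moore n d).
  move=> d0; have : Sigma L n <[moore n d]>%VS by exists d.
  rewrite -OS => -[f [V0f f0] fE]; have := memv_line f; rewrite -fE.
  case/vlineP=> c fcE; exists c; last by rewrite -fcE.
  by apply: contraNneq f0 => c0; rewrite fcE c0 scale0r.
(* The sum of the two vectors is again in [V0], hence a multiple of some [moore n g], as
   [moore_comb_ratio] requires. *)
have ratio_indep a b c d : a != 0 -> d != 0 -> b \notin <[d]>%VS ->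
    V0 (a *: moore n b) -> V0 (c *: moore n d) -> exists s : F, c = s%:A * a.
  move=> a0 d0 bd Vb Vd; have := V0P 1 _ _ Vb Vd; rewrite !scale1r.
  by case/ptV=> e [g /moore_comb_ratio]; apply.
have ratio a b c d : a != 0 -> c != 0 -> b != 0 -> d != 0 ->
    V0 (a *: moore n b) -> V0 (c *: moore n d) -> exists s : F, c = s%:A * a.
  move=> a0 c0 b0 d0 Vb Vd.
  have [bd|bd] := boolP (b \in <[d]>%VS); last exact: ratio_indep Vb Vd.
  (* For b and d on one F-line, compare both with a g off that line; there is
     none only if n = 1, and then L = F. *)
  have [dT|/subvPn[g _ gd]] := boolP ({:L} <= <[d]>)%VS.
    have /vlineP[s] : c / a * d \in <[d]>%VS by rewrite (subvP dT) ?memvf.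
    rewrite -mulr_algl => /(mulIf d0) sE; exists s.
    by rewrite -sE divfK.
  have gb : g \notin <[b]>%VS.
    by apply: contra gd; apply: subvP; rewrite -memvE.
  have [|e e0 Ve] := ptS g; first by apply: contraNneq gd => ->; apply: mem0v.
  have [s1 aE] := ratio_indep _ _ _ _ e0 b0 gb Ve Vb.
  have [s2 cE] := ratio_indep _ _ _ _ e0 d0 gd Ve Vd.
  have s10 : s1 != 0 by apply: contraNneq a0 => s10; rewrite aE s10 scale0r mul0r.
  by exists (s2 / s1); rewrite aE cE !mulr_algl scalerA divfK.
(* The multiplier over the point of [1] is the reference for all the others. *)
have [l l0 Vl] := ptS 1 (oner_neq0 _); exists l => //.
apply/seteqP; split=> [v V0v|_ [b _ <-]].
  have [v0|v0] := eqVneq v 0; first by exists 0; rewrite // moore0 scaler0 v0.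
  have [c [b vE]] := ptV _ V0v; rewrite vE in V0v v0 *.
  have [c0 b0] : c != 0 /\ b != 0.
    by move: v0; rewrite scaler_eq0 negb_or moore_eq0 => /andP.
  have [s ->] := ratio _ _ _ _ l0 c0 (oner_neq0 _) b0 Vl V0v.
  by exists (s *: b); rewrite // mooreZ scalerA mulrC.
have [->|b0] := eqVneq b 0; first by rewrite moore0 scaler0.
have [c c0 Vc] := ptS b b0.
have [s lE] := ratio _ _ _ _ c0 l0 b0 (oner_neq0 _) Vc Vl.
by have := V0P s _ _ Vc V00; rewrite addr0 scalerA -lE.
Qed.

Lemma moore_Fsubspace : Fsubspace [set moore n b | b in [set: L]].
Proof.
split=> [|a _ _ [b _ <-] [c _ <-]]; first by exists 0; rewrite // moore0.
by exists (a *: b + c); rewrite // mooreP.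
Qed.

Lemma Omega_moore : Omega [set moore n b | b in [set: L]] = Sigma L n.
Proof.
apply/seteqP; split=> [_ [_ [[b _ <-] +] ->]|_ [b b0 <-]].
  by rewrite moore_eq0 => b0; exists b.
by exists (moore n b); rewrite // moore_eq0; split=> //; exists b.
Qed.

Lemma evalv_dotmap k (f : k.-tuple 'rV[L]_n) x : evalv f x = dotmap f (moore n x).
Proof. by rewrite dotmapE; apply/rowP=> j; rewrite !mxE lpoly_dotp. Qed.

End Linearised.

(** * The quotient geometry and its linear sets *)

Lemma imgpts_quotpts (K : fieldType) (vT wT : vectType K) (S : {vspace vT})
    (phi : 'Hom(quotv S, wT)) I (A : set I) (p : I -> vT) :
  imgpts phi (quotpts S [set <[p i]>%VS | i in A]) =
    [set <[phi (projq S (p i))]>%VS | i in A].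
Proof.
apply/seteqP; split=> [_ [_ [_ [i Ai <-] <-] <-]|_ [i Ai <-]].
  by exists i; rewrite // limg_projq_add limg_line.
exists <[projq S (p i)]>%VS; last by rewrite limg_line.
by exists <[p i]>%VS; [exists i|rewrite limg_projq_add].
Qed.

Theorem mainTheorem8 (F : finFieldType) (L : fieldExtType F) (n k : nat)
    (C : {vspace 'rV[L]_n}) :
  \dim {:L} = n ->
  \dim C = k ->
  Omega [set` orthd C] `&` Sigma L n = set0 ->
  [/\ exists2 V0 : set 'rV[L]_n, Fsubspace V0 & Omega V0 = Sigma L n,
      forall f : k.-tuple 'rV[L]_n, basis_of C f ->
        (forall V0 : set 'rV[L]_n, Fsubspace V0 -> Omega V0 = Sigma L n ->
           lin_equiv (Uset f) (quotset (orthd C) V0)) /\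
        proj_equiv (Lset f) (quotpts (orthd C) (Sigma L n))
    & forall phi : 'Hom(quotv (orthd C), 'rV[L]_k), bijective phi ->
        Lclass k C (imgpts phi (quotpts (orthd C) (Sigma L n)))].
Proof.
move=> dimL _ _; split.
- by exists [set moore n b | b in [set: L]];
    [apply: moore_Fsubspace|apply: Omega_moore].
- move=> f /andP[/eqP spanC f_free].
  have [phi phi_bij phiE] := first_iso (limg_dotmap f_free).
  (* The type of [phi] mentions the kernel, so [phi] is generalised before the kernel is rewritten
     to [orthd C]. *)
  move: phi phi_bij phiE; rewrite lker_dotmap spanC => phi phi_bij phiE.
  split=> [V0 V0F V0S|].
    have [l l0 ->] := Omega_Sigma_scaled_moore dimL V0F V0S.
    (* [phi] sends [evalv f x] to the class of [moore n x]; the factor [l], possibly outside F, is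
       absorbed into the bijection. *)
    exists (l *: phi).
      have [psi phiK psiK] := phi_bij.
      exists (fun w => psi (l^-1 *: w)) => v.
        by rewrite lfunE /= scalerA mulVf // scale1r phiK.
      by rewrite lfunE /= psiK scalerA divff // scale1r.
    apply/seteqP; split=> [_ [_ [x _ <-] <-]|_ [_ [x _ <-] <-]].
      exists (l *: moore n x); first by exists x.
      by rewrite scale_lfunE evalv_dotmap phiE linearZ.
    exists (evalv f x); first by exists x.
    by rewrite scale_lfunE evalv_dotmap phiE linearZ.
  exists phi => //; apply/seteqP; split=> [_ [_ [x x0 <-] <-]|_ [_ [x x0 <-] <-]].
    exists <[moore n x]>%VS; first by exists x.
    by rewrite limg_projq_add limg_line evalv_dotmap phiE.
  exists <[evalv f x]>%VS; first by exists x.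
  by rewrite limg_projq_add limg_line evalv_dotmap phiE.
(* This composite has kernel [orthd C], as [phi] is injective; so the tuple [f] representing it
   spans [C] by double orthogonality. *)
move=> phi phi_bij; have [f fE] := dotmap_rows (phi \o projq (orthd C))%VF.
exists f.
  apply/esym/span_dotmap; rewrite fE; apply/vspaceP=> v.
  rewrite memv_ker comp_lfunE -projq0.
  by rewrite -(inj_eq (bij_inj phi_bij)) linear0.
rewrite imgpts_quotpts; apply: eq_imagel => x _ /=.
by rewrite evalv_dotmap fE comp_lfunE.
Qed.
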